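(* Let $\ell_1\leq\ell_2\leq\ell_3\leq\ell_4$ be positive integers and $e=\ell_1+\ell_2+\ell_3+\ell_4$. Then $$\lambda(S_{1,1,1,\ell_4})=\begin{cases}4&\text{if }e\leq10;\\ \left\lceil\frac{-1+\sqrt{8e+9}}{2}\right\rceil&\text{if }e\geq11\text{ and }\left\lceil\frac{-1+\sqrt{8e+9}}{2}\right\rceil\text{ is odd};\\ \left\lceil\sqrt{2e-4}\right\rceil&\text{otherwise,}\end{cases}$$ and if $\ell_3\geq2$, then $$\lambda(S_{\ell_1,\ell_2,\ell_3,\ell_4})=\begin{cases}4&\text{if }e\leq10\text{ and }\ell_1=1;\\5&\text{if }e\leq10\text{ and }\ell_1=2;\\ \left\lceil\frac{-1+\sqrt{8e+1}}{2}\right\rceil&\text{if }e\geq11\text{ and }\left\lceil\frac{-1+\sqrt{8e+1}}{2}\right\rceil\text{ is odd};\\ \left\lceil\sqrt{2e-4}\right\rceil&\text{otherwise.}\end{cases}$$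
   Context: For a graph $G$, the edge-distinguishing chromatic number $\lambda(G)$ is the minimum positive integer $k$ for which there is a vertex coloring $c:V(G)\to\{1,\dotsc,k\}$ such that the edge labels $\{c(u),c(v)\}$ are distinct for distinct edges $uv$. The spider graph $S_{\ell_1,\ell_2,\ell_3,\ell_4}$ is the tree with central vertex $x_0$ and four paths (legs) $x_0x^i_1\dotsb x^i_{\ell_i}$, $i=1,\dotsc,4$, of $\ell_i$ edges each, sharing only $x_0$; it has $\ell_1+\ell_2+\ell_3+\ell_4$ edges. *)

(* Defs.v *)
From mathcomp Require Import all_boot.

Set Implicit Arguments.
Unset Strict Implicit.
Unset Printing Implicit Defensive.

Record sgraph := SGraph {
  vert :> finType;
  adj : rel vert;
  adj_sym : symmetric adj;
  adj_irr : irreflexive adj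
}.

(* The colouring need not be proper: a monochromatic edge has the singleton
   [set c u; c u] as its label. *)
Definition edge_distinguishing (G : sgraph) (k : nat) (c : {ffun G -> 'I_k}) :
    bool :=
  [forall u : G, forall v : G, forall u' : G, forall v' : G,
     [&& adj u v, adj u' v' & [set u; v] != [set u'; v']] ==>
       ([set c u; c v] != [set c u'; c v'])].

Definition edge_colourable (G : sgraph) (k : nat) : bool :=
  (0 < k) && [exists c : {ffun G -> 'I_k}, edge_distinguishing c].

Lemma edge_colourable_ex (G : sgraph) : exists k, edge_colourable G k.
Proof.
exists #|G|.+1; rewrite /edge_colourable /=; apply/existsP.
pose f (x : G) : 'I_#|G|.+1 := widen_ord (leqnSn _) (enum_rank x).
have f_inj : injective f.
  by move=> x y /(congr1 val) /= /ord_inj /enum_rank_inj.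
exists [ffun x => f x]; apply/'forall_'forall_'forall_forallP => u v u' v'.
apply/implyP => /and3P[_ _]; apply: contra => /eqP.
rewrite !ffunE -!imset_set1 -!imsetU => /(imset_inj f_inj) ->.
exact: eqxx.
Qed.

Definition edge_distinguishing_number (G : sgraph) : nat :=
  ex_minn (edge_colourable_ex G).

Section Spider.
Variables (n : nat) (l : n.-tuple nat).

(* [None] is the central vertex x_0; [Some (Tagged _ j)] on leg i is the
   vertex x^i_(j+1), since j : 'I_(tnth l i) starts at 0. *)
Definition spider_vert : finType := option {i : 'I_n & 'I_(tnth l i)}.

Definition spider_next (u v : spider_vert) : bool :=
  match u, v with
  | None, Some y => tagged y == 0 :> nat
  | Some x, Some y => (tag x == tag y) && ((tagged x).+1 == tagged y :> nat)
  | _, None => false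
  end.

Definition spider_adj : rel spider_vert :=
  fun u v => spider_next u v || spider_next v u.

Lemma spider_adj_sym : symmetric spider_adj.
Proof. by move=> u v; rewrite /spider_adj orbC. Qed.

Lemma spider_adj_irr : irreflexive spider_adj.
Proof.
by case=> [x|] //; rewrite /spider_adj /= eqxx orbb /= eqn_leq ltnn.
Qed.

Definition spider : sgraph := SGraph spider_adj_sym spider_adj_irr.

End Spider.

(* Main.v *)
Require Import Defs.
From mathcomp Require Import all_boot all_order all_algebra.
From mathcomp Require Import zify lra.
From mathcomp Require Import reals.

(* A colouring of the spider with k colours that distinguishes edges is the same
   as four trails from one vertex v, pairwise edge-disjoint, in the complete graph
   on k vertices with a loop at each vertex.  That graph has k(k+1)/2 edges and
   all degrees k+1.  Only the ends of the four trails can have odd degree in their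
   union, so for even k at least (k-4)/2 edges are missed, and for odd k the legs
   1,1,1,l, with their three distinct short ends, miss at least one.

   Conversely all other edges can be used.  Extending the last leg, one may assume
   that their number is maximal, and then pass from k to k+2: the edges at the two
   new vertices a and b split into closed trails w1 a w2 b w3 a ... w1, which can
   be spliced into any leg visiting w1.  For odd k the four legs come from two
   closed trails at v of lengths l1+l3 and l2+l4, and everything new is spliced
   into the longer one; for even k the new edges are shared between the two
   longest legs.  The induction starts at k = 5, 7 and k = 6. *)

Set Implicit Arguments.
Unset Strict Implicit.
Unset Printing Implicit Defensive.

(** * Edge-disjoint trails from a common vertex *)

(* The unordered pair {x, y} is encoded as (min, max). *)
Definition upair (x y : nat) : nat * nat := (minn x y, maxn x y).

Lemma upairC x y : upair x y = upair y x.
Proof. by rewrite /upair minnC maxnC. Qed.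

Fixpoint walk_edges (x : nat) (p : seq nat) : seq (nat * nat) :=
  if p is y :: p' then upair x y :: walk_edges y p' else [::].

Lemma walk_edges_cat x p q :
  walk_edges x (p ++ q) = walk_edges x p ++ walk_edges (last x p) q.
Proof. by elim: p x => //= y p IHp x; rewrite IHp. Qed.

Lemma walk_edges_split n x p : walk_edges x p =
  walk_edges x (take n p) ++ walk_edges (last x (take n p)) (drop n p).
Proof. by rewrite -walk_edges_cat cat_take_drop. Qed.

Lemma size_walk_edges x p : size (walk_edges x p) = size p.
Proof. by elim: p x => //= y p IHp x; rewrite IHp. Qed.

Lemma walk_edges_nth d x p :
  walk_edges x p =
  [seq upair (nth d (x :: p) j) (nth d p j) | j <- iota 0 (size p)].
Proof.
elim: p x => //= y p IHp x; congr (_ :: _); rewrite IHp.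
by rewrite (iotaDl 1 0) -map_comp; apply: eq_map.
Qed.

Lemma walk_edges_rev x p :
  perm_eq (walk_edges (last x p) (rev (belast x p))) (walk_edges x p).
Proof.
elim: p x => //= y p IHp x.
rewrite rev_cons -cats1 walk_edges_cat perm_catC /=.
have -> : last (last y p) (rev (belast y p)) = y.
  by case: p {IHp} => //= z p; rewrite rev_cons last_rcons.
by rewrite upairC perm_cons.
Qed.

(** The closed trail [c] is inserted at a visit to [w]; the end of the walk is kept, so closed
    trails stay closed. *)
Lemma walk_insert v p w c : w \in v :: p -> last w c = w ->
  exists p', [/\ size p' = size p + size c, last v p' = last v p
    & perm_eq (walk_edges v p') (walk_edges w c ++ walk_edges v p)].
Proof.
move=> /splitPl[p1 p2 p1w] cw; exists (p1 ++ c ++ p2); split.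
- by rewrite !size_cat; lia.
- by rewrite !last_cat p1w cw.
- apply/permP => P; rewrite !walk_edges_cat !count_cat p1w cw; lia.
Qed.

(** [upair] puts the larger end second, so a bound on [e.2] bounds both ends. *)
Definition good (k : nat) (E : seq (nat * nat)) : bool :=
  all (fun e => e.2 < k) E && uniq E.

Lemma good_perm k E E' : perm_eq E E' -> good k E = good k E'.
Proof. by move=> EE'; rewrite /good (perm_all _ EE') (perm_uniq EE'). Qed.

Lemma good_catr k E E' : good k (E ++ E') -> good k E'.
Proof. by rewrite /good all_cat cat_uniq => /andP[/andP[_ ->] /and3P[]]. Qed.

Lemma good_leq k k' E : k <= k' -> good k E -> good k' E.
Proof.
move=> kk' /andP[Ek EU]; rewrite /good EU andbT.
by apply: sub_all Ek => e /= /leq_trans; apply.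
Qed.

Definition legs_edges v ps := flatten [seq walk_edges v p | p <- ps].

(* A leg from the centre colour [v] is the list [p] of the colours after [v]. *)
Definition legs k v ps : bool := (v < k) && good k (legs_edges v ps).

Definition realisable (k : nat) (ls : seq nat) : Prop :=
  exists v ps, map size ps = ls /\ legs k v ps.

Lemma realisable_perm k ls ls' :
  perm_eq ls ls' -> realisable k ls -> realisable k ls'.
Proof.
move=> + [v [ps [sz_ps /andP[vk gps]]]].
rewrite -{ls}sz_ps perm_sym => /perm_iotaP-/(_ 0)[s].
rewrite size_map => ps_s ls'E.
exists v, [seq nth [::] ps i | i <- s]; split.
  rewrite ls'E -map_comp; apply/eq_in_map => i.
  by rewrite (perm_mem ps_s) mem_iota => /= ltis; rewrite (nth_map [::]).
rewrite /legs vk; apply: etrans gps; apply: good_perm.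
apply: perm_flatten; apply: perm_map.
by rewrite -[X in perm_eq _ X](mkseq_nth [::]); apply: perm_map.
Qed.

Lemma realisable_leq k k' ls : k <= k' -> realisable k ls -> realisable k' ls.
Proof.
move=> kk' [v [ps [sz /andP[vk /(good_leq kk') gps]]]].
by exists v, ps; rewrite /legs gps (leq_trans vk).
Qed.

Lemma realisable_take k l l' ls :
  l' <= l -> realisable k (l :: ls) -> realisable k (l' :: ls).
Proof.
move=> ll' [v [[|p ps] [//= [sz szs] /andP[vk gps]]]].
exists v, (take l' p :: ps); rewrite /legs vk /= szs size_takel ?sz//.
split=> //; apply: (@good_catr _ (walk_edges (last v (take l' p)) (drop l' p))).
apply: etrans gps; apply: good_perm.
rewrite /legs_edges /= (walk_edges_split l' v p).
apply/permP => P; rewrite !count_cat; lia.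
Qed.

(* Two edge-disjoint trails [c] sharing a vertex, at positions [i] and [j], are
   four legs from that vertex: both trails are cut there. *)
Definition joint_trails (k : nat) (c : seq nat * seq nat) : bool :=
  [&& head 0 c.1 < k, head 0 c.2 < k &
   good k (walk_edges (head 0 c.1) (behead c.1) ++
           walk_edges (head 0 c.2) (behead c.2))].

Definition cut_lengths (c : seq nat * seq nat) : seq (seq nat) :=
  [seq [:: i; (size c.1).-1 - i; j; (size c.2).-1 - j] |
     i <- iota 0 (size c.1),
     j <- [seq j <- iota 0 (size c.2) | nth 0 c.1 i == nth 0 c.2 j]].

Lemma split_walk x p i (w := nth 0 (x :: p) i) : i <= size p ->
  perm_eq (walk_edges w (rev (belast x (take i p))) ++ walk_edges w (drop i p))
          (walk_edges x p).
Proof.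
move=> ip; have -> : w = last x (take i p).
  by rewrite (last_nth 0) size_takel // /w; case: i ip {w} => //= i ip;
     rewrite nth_take.
rewrite (walk_edges_split i x p) perm_cat2r.
exact: walk_edges_rev.
Qed.

Lemma good_walk_lt k x p E i :
  x < k -> good k (walk_edges x p ++ E) -> i <= size p -> nth 0 (x :: p) i < k.
Proof.
move=> xk /andP[]; rewrite all_cat => /andP[+ _] _; case: i => // i.
by elim: p x xk i => //= y p IHp x xk [|i] /andP[]; rewrite gtn_max;
  move=> /andP[_ yk] // /IHp; apply.
Qed.

Lemma realisable_cut k c ls : joint_trails k c -> ls \in cut_lengths c ->
  realisable k ls.
Proof.
case: c => -[|x p] [|y q] /and3P[/= xk yk g];
  case/allpairsPdep => i [j []]; rewrite mem_filter !mem_iota /= ?andbF //.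
rewrite !ltnS => ip /andP[/eqP wE jq] ->.
exists (nth 0 (x :: p) i), [:: rev (belast x (take i p)); drop i p;
                               rev (belast y (take j q)); drop j q].
split; first by rewrite /= !size_rev !size_belast !size_drop !size_takel.
rewrite /legs (good_walk_lt xk g ip) /legs_edges /= cats0.
apply: etrans g; apply: good_perm; rewrite catA perm_cat ?split_walk//.
by rewrite wE split_walk.
Qed.

(** A closed trail at [v] can be cut after any number of edges: the rest, read backwards, also
    starts at [v]. *)
Lemma realisable_closed k v p q i j :
  legs k v [:: p; q] -> last v p = v -> last v q = v ->
  i <= size p -> j <= size q ->
  realisable k [:: i; size p - i; j; size q - j].
Proof.
move=> /andP[vk g] pv qv ip jq.
pose back p i := rev (belast (last v (take i p)) (drop i p)).
exists v, [:: take i p; back p i; take j q; back q j]; split.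
  by rewrite /= !size_rev !size_belast !size_drop !size_takel.
have split_closed r n : last v r = v ->
  perm_eq (walk_edges v (take n r) ++ walk_edges v (back r n)) (walk_edges v r).
  move=> rv; rewrite (walk_edges_split n v r) perm_cat2l.
  rewrite /back -[X in walk_edges X]rv -[in last v r](cat_take_drop n r) last_cat.
  exact: walk_edges_rev.
rewrite /legs vk; apply: etrans g; apply: good_perm; rewrite /legs_edges /=.
by rewrite !cats0 catA perm_cat ?split_closed.
Qed.

(** * Splicing in two new colours *)

Fixpoint zigzag (a b : nat) (s : seq nat) : seq nat :=
  a :: (if s is w :: s' then w :: zigzag b a s' else [::]).

Lemma size_zigzag a b s : size (zigzag a b s) = (size s).*2.+1.
Proof. by elim: s a b => //= w s IHs a b; rewrite IHs doubleS. Qed.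

Lemma last_zigzag v a b s :
  last v (zigzag a b s) = if odd (size s) then b else a.
Proof. by elim: s v a b => //= w s IHs v a b; rewrite IHs; case: odd. Qed.

(** Each [w] in [s] stands between an [a] and a [b], in some order, and so gets one edge to each;
    only the start [v] gets a single edge. *)
Lemma walk_edges_zigzag v a b s :
  perm_eq (walk_edges v (zigzag a b s))
          (upair v a :: [seq upair x a | x <- s] ++ [seq upair x b | x <- s]).
Proof.
elim: s v a b => //= w s IHs v a b; apply/permP => P.
by have /permP/(_ P) := IHs w b a; rewrite /= !count_cat /= (upairC a w); lia.
Qed.

(* The closed trail [v, a, w1, b, w2, a, w3, ..., v] through
   [v :: s = v :: w1 :: w2 :: ...]; when [v :: s] has odd length it ends with
   [a, b, v]. *)
Definition circuit (a b v : nat) (s : seq nat) : seq nat :=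
  zigzag a b s ++ (if odd (size s) then [:: v] else [:: b; v]).

Lemma size_circuit a b v s :
  size (circuit a b v s) = (size s).+1.*2 + odd (size s).+1.
Proof. by rewrite size_cat size_zigzag /=; case: odd => /=; lia. Qed.

Lemma last_circuit a b v s : last v (circuit a b v s) = v.
Proof. by rewrite last_cat; case: odd. Qed.

Lemma walk_edges_circuit a b v s :
  perm_eq (walk_edges v (circuit a b v s))
    ([seq upair x a | x <- v :: s] ++ [seq upair x b | x <- v :: s] ++
     nseq (odd (size s).+1) (upair a b)).
Proof.
apply/permP => P; rewrite walk_edges_cat count_cat last_zigzag.
have /permP/(_ P) -> := walk_edges_zigzag v a b s.
rewrite !count_cat /= count_cat; case: odd => /=;
  rewrite (upairC b v) /=; lia.
Qed.

Lemma circuit_loops a b v s (c := circuit a b v s) :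
  exists c', [/\ last v c' = v, size c' = size c + 2 &
    perm_eq (walk_edges v c')
            ([:: upair a a; upair b b] ++ walk_edges v c)].
Proof.
have [c0 cE] : exists c0, c = a :: c0 by rewrite /c /circuit; case: (s) => *; eexists.
(* As [c] starts with [a], the walk [a :: c] already contains the loop at [a]; the loop at [b] is
   then inserted at a visit to [b]. *)
have bc : b \in v :: a :: c.
  rewrite 2!inE; apply/orP; right; apply/orP; right.
  rewrite /c /circuit mem_cat; case: ifP => [|_]; last first.
    by rewrite !inE eqxx !orbT.
  case: (s) => // w s' _; apply/orP; left.
  by case: s' => [|w' s'] /=; rewrite !inE eqxx !orbT.
have [c' [sz' last' E']] := walk_insert bc (erefl : last b [:: b] = b).
exists c'; split.
- by rewrite last' cE /= -(last_circuit a b v s) -/c cE.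
- by rewrite sz' /= addn1 addn2.
apply: perm_trans E' _; rewrite cE /=.
apply/permP => P /=; lia.
Qed.

(** All new edges have second entry [k], which no edge of [E] has; [x = k] gives the loop. *)
Lemma good_star k E s : all (fun x => x <= k) s -> uniq s -> good k E ->
  good k.+1 ([seq upair x k | x <- s] ++ E).
Proof.
move=> sk sU /andP[Ek EU].
have upk x : x <= k -> upair x k = (x, k).
  by move=> xk; rewrite /upair (minn_idPl xk) (maxn_idPr xk).
have -> : [seq upair x k | x <- s] = [seq (x, k) | x <- s].
  by apply/eq_in_map => x /(allP sk) /upk.
rewrite /good all_cat all_map /= (sub_all _ Ek) => [|e /= /ltnW //].
rewrite cat_uniq EU map_inj_uniq ?sU => [|x y []//]; rewrite !andbT /=.
apply/andP; split; first by apply/allP => x _ /=.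
apply/hasPn => -[x y] /(allP Ek) /= yk; apply/mapP => -[z _ [_ yE]].
by rewrite yE ltnn in yk.
Qed.

Lemma good_new_edges k s (b : bool) E : perm_eq s (iota 0 k) -> good k E ->
  good k.+2 ([:: upair k k; upair k.+1 k.+1] ++
    [seq upair x k | x <- s] ++ [seq upair x k.+1 | x <- s] ++
    nseq b (upair k k.+1) ++ E).
Proof.
move=> sk gE.
have s_lt x : x \in s -> x < k by rewrite (perm_mem sk) mem_iota.
have sU : uniq s by rewrite (perm_uniq sk) iota_uniq.
have g1 : good k.+1 ([seq upair x k | x <- k :: s] ++ E).
  apply: good_star gE => /=; last by rewrite sU andbT; apply/negP => /s_lt; lia.
  by rewrite leqnn; apply/allP => x /s_lt; lia.
have g2 : good k.+2 ([seq upair x k.+1 | x <- k.+1 :: nseq b k ++ s] ++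
                     ([seq upair x k | x <- k :: s] ++ E)).
  apply: good_star g1; last first.
    rewrite /= mem_cat cat_uniq sU negb_or -andbA; apply/and5P; split.
    - by case: b; rewrite //= inE; lia.
    - by apply/negP => /s_lt; lia.
    - by case: b.
    - by apply/hasPn => x /s_lt; case: b; rewrite //= inE; lia.
    - by [].
  rewrite /= leqnn all_cat /=; apply/andP; split; first by case: b => //=; lia.
  by apply/allP => x /s_lt; lia.
apply: etrans g2; apply: good_perm; apply/permP => P.
by rewrite !map_cons map_cat map_nseq /= !count_cat /= count_cat; lia.
Qed.

Lemma perm_head (T : eqType) (x : T) s : x \in s ->
  exists s', perm_eq (x :: s') s.
Proof. by move=> xs; exists (rem x s); rewrite perm_sym perm_to_rem. Qed.

(** One circuit through all [k] old colours takes [2k] edges, and for odd [k] also the edge between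
    the new colours; the last 2 are the new loops. *)
Lemma legs_lift1 k v p ps : legs k v (p :: ps) ->
  exists p', [/\ size p' = size p + k.*2 + odd k + 2, last v p' = last v p
    & legs k.+2 v (p' :: ps)].
Proof.
move=> /andP[vk g].
have [s sE] : exists s, perm_eq (v :: s) (iota 0 k).
  by apply: perm_head; rewrite mem_iota.
have sz_s : (size s).+1 = k by rewrite -(size_iota 0 k) -(perm_size sE).
have [c [cv c_sz cE]] := circuit_loops k k.+1 v s.
have [p' [p'_sz p'v p'E]] := walk_insert (mem_head v p) cv.
exists p'; split=> //.
  by rewrite p'_sz c_sz size_circuit sz_s !addnA.
rewrite /legs (leq_trans vk) 1?ltnW //=.
apply: etrans (good_new_edges (odd k) sE g); apply: good_perm.
rewrite -sz_s in cE *; apply/permP => P; rewrite /legs_edges /= !count_cat.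
move/permP/(_ P): p'E; move/permP/(_ P): cE.
move/permP/(_ P): (walk_edges_circuit (size s).+1 (size s).+2 v s).
by do !rewrite /= count_cat; lia.
Qed.

(** The first edges of the two legs differ, so at most one of them is the loop at [v]. This gives
    distinct base points for two circuits. *)
Lemma legs_neq k v p q ps : legs k v (p :: q :: ps) ->
  0 < size p -> 0 < size q ->
  exists2 x : nat, x \in v :: p & exists2 y : nat, y \in v :: q &
    [&& x != y, x < k & y < k].
Proof.
case: p q => [|x p] [|y q] //= /andP[vk /andP[/allP/= E_lt /andP[vx _]]] _ _.
have xk : x < k.
  by have := E_lt _ (mem_head _ _); rewrite gtn_max => /andP[].
have vy_in : upair v y \in walk_edges x p ++ upair v y :: walk_edges y q ++
    legs_edges v ps by rewrite mem_cat mem_head orbT.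
have yk : y < k.
  by have := E_lt _ (mem_behead (s := _ :: _) vy_in); rewrite gtn_max => /andP[].
have [xv|xv] := eqVneq x v; last first.
  exists x; first by rewrite !inE eqxx orbT.
  by exists v; rewrite ?mem_head // xv xk vk.
exists v; first exact: mem_head.
exists y; first by rewrite !inE eqxx orbT.
rewrite vk yk !andbT; apply: contraNneq vx => vy.
by have -> : upair v x = upair v y by rewrite xv -vy.
Qed.

(** One circuit runs through [m] old colours, another through the other [k - m]. Since [m] is even,
    only the second can use the edge between the new colours, and it does so exactly for odd [k]. *)
Lemma legs_lift2 k v p q ps m : legs k v (p :: q :: ps) ->
  0 < size p -> 0 < size q -> 0 < m < k -> ~~ odd m ->
  exists p' q', [/\ size p' = size p + m.*2 + 2,
    size q' = size q + (k - m).*2 + odd k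
    & legs k.+2 v (p' :: q' :: ps)].
Proof.
move=> L p0 q0 /andP[m0 mk] m_even.
have [x xp [y yq /and3P[xy xk yk]]] := legs_neq L p0 q0.
case/andP: L => vk g.
have [s1 s1E] : exists s : seq nat, perm_eq (x :: s) (iota 0 k).
  by apply: perm_head; rewrite mem_iota.
have [s sE] : exists s : seq nat, perm_eq (y :: s) s1.
  apply: perm_head; have := perm_mem s1E y.
  by rewrite inE eq_sym (negPf xy) mem_iota yk.
have sz_s1 : (size s1).+1 = k by rewrite -(size_iota 0 k) -(perm_size s1E).
have sz_s : (size s).+1 = size s1 by rewrite -(perm_size sE).
pose sx := take m.-1 s; pose sy := drop m.-1 s.
have sz_sx : (size sx).+1 = m by rewrite size_takel; lia.
have sz_sy : (size sy).+1 = k - m by rewrite size_drop; lia.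
have odd_km : odd (k - m) = odd k by rewrite oddB ?(negPf m_even) ?addbF // ltnW.
have [c [cx c_sz cE]] := circuit_loops k k.+1 x sx.
have [p' [p'_sz _ p'E]] := walk_insert xp cx.
have [q' [q'_sz _ q'E]] := walk_insert yq (last_circuit k k.+1 y sy).
exists p', q'; split.
- by rewrite p'_sz c_sz size_circuit sz_sx (negPf m_even) addn0 addnA.
- by rewrite q'_sz size_circuit sz_sy odd_km addnA.
rewrite /legs (leq_trans vk) 1?ltnW //=.
have kE : perm_eq ((x :: sx) ++ (y :: sy)) (iota 0 k).
  apply: perm_trans s1E; rewrite /= perm_cons; apply: perm_trans sE.
  by rewrite -cat1s perm_catCA /= perm_cons cat_take_drop.
apply: etrans (good_new_edges (odd k) kE g); apply: good_perm.
have legs_edges2 r1 r2 : legs_edges v [:: r1, r2 & ps] =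
  walk_edges v r1 ++ walk_edges v r2 ++ legs_edges v ps by [].
(* Counts of explicit lists are kept folded: [lia] would split on each bool. *)
apply/permP => P; rewrite !legs_edges2 !map_cat !count_cat.
have /permP/(_ P) := p'E; have /permP/(_ P) := q'E; have /permP/(_ P) := cE.
have /permP/(_ P) := walk_edges_circuit k k.+1 x sx.
have /permP/(_ P) := walk_edges_circuit k k.+1 y sy.
rewrite sz_sx sz_sy odd_km (negPf m_even) !count_cat.
rewrite (_ : count P (nseq false _) = 0) // => -> -> -> -> ->; clear; lia.
Qed.

(** * Constructions with the maximal number of edges *)

Lemma realisable_lift1 k l ls : realisable k (l :: ls) ->
  realisable k.+2 (l + k.*2 + odd k + 2 :: ls).
Proof.
move=> [v [[|p ps] [//= [<- <-]]]] /legs_lift1[p' [<- _ L]].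
by exists v, (p' :: ps).
Qed.

Lemma realisable_lift2 k l l' ls m : realisable k [:: l, l' & ls] ->
  0 < l -> 0 < l' -> 0 < m < k -> ~~ odd m ->
  realisable k.+2 [:: l + m.*2 + 2, l' + (k - m).*2 + odd k & ls].
Proof.
move=> [v [[|p [|q ps]] [//= [<- <- <-]]]] L p0 q0 mk m_even.
have [p' [q' [<- <- L']]] := legs_lift2 L p0 q0 mk m_even.
by exists v, [:: p', q' & ps].
Qed.

Lemma realisable_catC k s t : realisable k (s ++ t) -> realisable k (t ++ s).
Proof. by apply: realisable_perm; rewrite perm_catC. Qed.

(** * Finite tables and the even case *)

Lemma perm_sort4 (P : seq nat -> Prop) :
  (forall s t, perm_eq s t -> P s -> P t) ->
  (forall a b c d, a <= b -> b <= c -> c <= d -> P [:: a; b; c; d]) ->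
  forall a b c d, P [:: a; b; c; d].
Proof.
move=> permP sortedP a b c d; set s := [:: a; b; c; d].
have := sort_sorted leq_total s; have := perm_sort leq s.
case: sort (size_sort leq s) => [|x [|y [|z [|t []]]]] // _ /permPl pE.
move=> /= /and4P[xy yz zt _]; apply: permP pE _; exact: sortedP.
Qed.

(** Once [a + b + c] reaches [n], the truncated difference is 0 and the guard fails for the positive
    [c], so the generous ranges add no cases. *)
Definition all_partitions4 (n m : nat) (tbl : seq (seq nat)) : bool :=
  all (fun a => all (fun b => all (fun c =>
      (c <= n - (a + b + c)) ==> ([:: a; b; c; n - (a + b + c)] \in tbl))
    (iota b n)) (iota a n)) (iota 1 m).

Lemma all_partitions4P n m tbl a b c d : all_partitions4 n m tbl ->
  a + b + c + d = n -> 0 < a <= m -> a <= b -> b <= c -> c <= d ->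
  [:: a; b; c; d] \in tbl.
Proof.
move=> /allP allt sE am ab bc cd.
have in_iota i j : i <= j -> j <= n -> 0 < i -> j \in iota i n.
  by rewrite mem_iota; lia.
have /allt/allP/(_ b) : a \in iota 1 m by rewrite mem_iota; lia.
rewrite in_iota => [/(_ isT)/allP/(_ c)|||]; try lia.
rewrite in_iota => [/(_ isT)|||]; try lia.
have -> : n - (a + b + c) = d by lia.
by rewrite cd.
Qed.

Lemma realisable_table k n m cs a b c d : all (joint_trails k) cs ->
  all_partitions4 n m (flatten [seq map (sort leq) (cut_lengths e) | e <- cs]) ->
  a + b + c + d = n -> 0 < a <= m -> a <= b -> b <= c -> c <= d ->
  realisable k [:: a; b; c; d].
Proof.
move=> /allP csk tbl sE am ab bc cd.
have /flattenP[_ /mapP[e e_cs ->] /mapP[s s_cut ->]] :=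
  all_partitions4P tbl sE am ab bc cd.
apply: (@realisable_perm _ s); first by rewrite perm_sym perm_sort.
exact: realisable_cut (csk _ e_cs) s_cut.
Qed.

(* Found by computer search: cutting these pairs of trails at their common
   vertices gives every partition 1 + b + c + d = 10 into four legs, and for
   [trails6] every partition of 20. *)
Definition trails4 : seq (seq nat * seq nat) := [::
  ([:: 1; 1; 0; 2; 2; 3; 3], [:: 0; 0; 3; 1; 2]);
  ([:: 1; 0; 0], [:: 3; 1; 1; 2; 2; 3; 3; 0; 2]);
  ([:: 2; 2; 3; 3; 1; 1; 0; 0], [:: 3; 0; 2; 1]);
  ([:: 0; 0; 3; 3; 1], [:: 3; 2; 2; 0; 1; 1; 2]);
  ([:: 2; 2; 3; 3; 0; 0], [:: 3; 1; 1; 2; 0; 1])].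

Definition trails6 : seq (seq nat * seq nat) := [::
  ([:: 3; 0; 0; 2; 5; 3; 3; 1; 4; 0],
   [:: 1; 1; 5; 5; 0; 1; 2; 3; 4; 4; 2; 2]);
  ([:: 0; 0; 2; 1; 1; 3; 3; 4; 4; 0; 5; 5; 1],
   [:: 3; 0; 1; 4; 2; 2; 5; 3; 2]);
  ([:: 0; 0; 4; 2; 1; 1; 5; 5; 0; 3; 3],
   [:: 1; 3; 4; 4; 1; 0; 2; 2; 3; 5; 2]);
  ([:: 3; 3; 4; 4; 0; 1; 5; 5; 0; 3; 5; 2; 2; 1; 1],
   [:: 0; 0; 2; 3; 1; 4; 2]);
  ([:: 0; 2; 5; 5; 1; 1; 4; 4; 2; 1; 3; 0; 0; 4; 3; 3],
   [:: 2; 2; 3; 5; 0; 1]);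
  ([:: 0; 4; 4; 2; 5; 5; 3; 3; 2; 0; 0; 5; 1; 1],
   [:: 3; 1; 4; 3; 0; 1; 2; 2]);
  ([:: 3; 4; 4; 1; 5; 5; 2; 0; 5; 3; 0; 1; 1; 3; 3; 2; 2],
   [:: 0; 0; 4; 2; 1]);
  ([:: 3; 0; 1; 1; 5; 0; 4; 4; 3; 2; 2; 1],
   [:: 0; 0; 2; 5; 5; 3; 3; 1; 4; 2]);
  ([:: 1; 4; 0],
   [:: 3; 4; 4; 2; 0; 3; 2; 5; 5; 1; 1; 3; 3; 5; 0; 0; 1; 2; 2]);
  ([:: 1; 5; 5; 3; 3; 1; 4; 4; 2; 2; 0; 1; 1; 2; 3],
   [:: 0; 0; 4; 3; 0; 5; 2]);
  ([:: 1; 1; 0; 0; 5; 5; 2; 2; 0],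
   [:: 2; 4; 3; 3; 5; 1; 2; 3; 1; 4; 4; 0; 3]);
  ([:: 3; 1; 1; 5; 5; 3; 2; 2; 4; 4; 0],
   [:: 2; 0; 0; 1; 4; 3; 3; 0; 5; 2; 1])].

Lemma realisable4 b c d : 0 < b -> b <= c -> c <= d -> 1 + b + c + d = 10 ->
  realisable 4 [:: 1; b; c; d].
Proof.
move=> b0 bc cd sE.
by apply: (@realisable_table 4 10 1 trails4) => //; vm_compute.
Qed.

Lemma realisable6 a b c d : 0 < a -> a <= b -> b <= c -> c <= d ->
  a + b + c + d = 20 -> realisable 6 [:: a; b; c; d].
Proof.
move=> a0 ab bc cd sE.
apply: (@realisable_table 6 20 5 trails6) => //; [by vm_compute..|lia].
Qed.

(** From [k] to [k + 2] the total grows by [2k + 2]: every new edge except the one between the new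
    colours. The longest leg absorbs them alone if it exceeds [2k + 2]; otherwise the two longest
    legs share them. *)
Lemma realisable_even k a b c d : ~~ odd k -> 6 <= k ->
  all (leq 1) [:: a; b; c; d] -> 2 * sumn [:: a; b; c; d] = k * k + 4 ->
  realisable k [:: a; b; c; d].
Proof.
move=> k_even k6.
have {k_even k6 k}[m ->] : exists m, k = m.*2 + 6.
  exists (k - 6)./2; lia.
have permP n h s t : perm_eq s t ->
    (all (leq 1) s -> 2 * sumn s = h -> realisable n s) ->
    all (leq 1) t -> 2 * sumn t = h -> realisable n t.
  move=> st IHs; rewrite -(perm_all _ st) -(perm_sumn st) => s0 sE.
  exact: realisable_perm st (IHs s0 sE).
elim: m a b c d => [|m IHm]; apply: (perm_sort4 (permP _ _)) => a b c d.
  move=> ab bc cd /= /andP[a0 _] sE; apply: realisable6 => //; lia.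
move=> ab bc cd; set k := m.*2 + 6 in IHm *; rewrite (_ : m.+1.*2 + 6 = k.+2); last by lia.
have k_even : odd k = false by lia.
move=> /= /and5P[a0 b0 c0 d0 _] sE; have [dk|dk] := leqP k.*2.+3 d.
  have R : realisable k [:: a; b; c; d - (k.*2 + 2)] by apply: IHm => /=; lia.
  have := realisable_lift1 (@realisable_catC k [:: a; b; c] [:: _] R).
  rewrite k_even (_ : _ - _ + _ + _ + _ = d); last by lia.
  exact: (@realisable_catC k.+2 [:: d] [:: a; b; c]).
(* Leg [c] receives x.*2 old vertices and both loops, leg [d] the rest. *)
set x := k %/ 4; have xk : 4 * x <= k < 4 * x + 4 by lia.
have c_ge : 4 * x + 3 <= c.
  (* From [a, b <= c] and [d <= 2k + 2], twice the total gives [(k + 2)^2 + 4 <= 6c + 4k + 4]. *)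
  have c6 : k * k + 4 <= 6 * c by clearbody k; lia.
  have [k8|k_lt] := leqP 8 k.
    have : 8 * k <= k * k by rewrite leq_mul2r k8 orbT.
    by clearbody k; lia.
  by have k6 : k = 6; [lia | rewrite k6 in c6; lia].
have d_ge : (k - x.*2).*2 < d by nia.
have R : realisable k [:: a; b; c - (x.*2.*2 + 2); d - (k - x.*2).*2].
  apply: IHm => /=; lia.
have := @realisable_lift2 _ _ _ _ x.*2
  (@realisable_catC k [:: a; b] [:: _; _] R)
  ltac:(lia) ltac:(lia) ltac:(lia) ltac:(lia).
rewrite k_even.
rewrite (_ : c - _ + _ + _ = c); last by lia.
rewrite (_ : d - _ + _ + _ = d); last by lia.
exact: (@realisable_catC k.+2 [:: c; d] [:: a; b]).
Qed.

(** * Pairs of closed trails for odd [k], where all degrees [k + 1] are even *)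

Definition closed_pair (k s t : nat) : Prop :=
  exists v p q, [/\ legs k v [:: p; q], last v p = v, last v q = v,
                    size p = s & size q = t].

Lemma closed_pairC k s t : closed_pair k s t -> closed_pair k t s.
Proof.
move=> [v [p [q [/andP[vk g] pv qv ps qt]]]]; exists v, q, p; split=> //.
rewrite /legs vk; apply: etrans g; apply: good_perm.
by rewrite /legs_edges /= !cats0 perm_catC.
Qed.

Lemma closed_pair_lift k s t : closed_pair k s t ->
  closed_pair k.+2 (s + k.*2 + odd k + 2) t.
Proof.
move=> [v [p [q [/legs_lift1[p' [p's p'v L]] pv qv ps qt]]]].
by exists v, p', q; rewrite p's p'v ps.
Qed.

Lemma closed_pair_trails k v p q : legs k v [:: p; q] -> last v p = v ->
  last v q = v -> closed_pair k (size p) (size q).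
Proof. by move=> *; exists v, p, q. Qed.

(** Length 2 is impossible for a closed trail: its second edge would repeat the first. *)
Lemma closed_pair5 s t : 3 <= s <= t -> s + t = 15 -> closed_pair 5 s t.
Proof.
move=> st sE; have -> : t = 15 - s by lia.
have {st sE} : s \in iota 3 5 by rewrite mem_iota; lia.
rewrite !inE => /or4P[/eqP->|/eqP->|/eqP->|/orP[]/eqP->].
- exact: (@closed_pair_trails 5 4 [:: 1; 3; 4]
           [:: 0; 2; 3; 3; 0; 0; 1; 1; 2; 2; 4; 4]).
- exact: (@closed_pair_trails 5 4 [:: 3; 3; 1; 4]
           [:: 2; 2; 0; 3; 2; 1; 1; 0; 0; 4; 4]).
- exact: (@closed_pair_trails 5 1 [:: 4; 4; 3; 2; 1]
           [:: 1; 3; 3; 0; 4; 2; 2; 0; 0; 1]).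
- exact: (@closed_pair_trails 5 2 [:: 4; 4; 3; 3; 2; 2]
           [:: 1; 0; 3; 1; 1; 4; 0; 0; 2]).
- exact: (@closed_pair_trails 5 1 [:: 4; 0; 0; 3; 3; 1; 1]
           [:: 2; 2; 3; 4; 4; 2; 0; 1]).
Qed.

(** Lifting from 5 colours adds 13 edges to the longer trail, which before had [15 - s]. This is at
    least 3 unless [s] is 13 or 14; those two cases get explicit trails. *)
Lemma closed_pair7 s t : 3 <= s <= t -> s + t = 28 -> closed_pair 7 s t.
Proof.
move=> st sE; have [s12|s13] := leqP s 12.
  have -> : t = t - 13 + 5.*2 + odd 5 + 2 by rewrite /=; lia.
  apply/closed_pairC/closed_pair_lift.
  have [s7|s8] := leqP s 7; last by apply: closed_pair5; lia.
  by apply/closed_pairC/closed_pair5; lia.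
have [[-> ->]|[-> ->]] : s = 13 /\ t = 15 \/ s = 14 /\ t = 14 by lia.
- exact: (@closed_pair_trails 7 6 [:: 1; 1; 4; 4; 2; 3; 3; 1; 0; 5; 3; 4; 6]
           [:: 5; 2; 2; 1; 5; 5; 4; 0; 0; 6; 3; 0; 2; 6; 6]).
- exact: (@closed_pair_trails 7 4 [:: 0; 6; 6; 3; 1; 5; 5; 2; 0; 0; 5; 6; 1; 4]
           [:: 2; 2; 6; 4; 5; 3; 0; 1; 1; 2; 3; 3; 4; 4]).
Qed.

(** On [k + 2] colours the longer trail has at least [(k + 2)(k + 3) / 4] edges; for [k >= 7] at
    least 3 remain after removing the [2k + 3] new ones. *)
Lemma closed_pair_odd k s t : odd k -> 5 <= k -> 3 <= s <= t ->
  2 * (s + t) = k * k.+1 -> closed_pair k s t.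
Proof.
move=> k_odd k5; have [->|k7] := eqVneq k 5; first by move=> ? ?; apply: closed_pair5 => //; lia.
have {k_odd k5 k7 k}[m ->] : exists m, k = m.*2 + 7.
  exists (k - 7)./2; lia.
elim: m s t => [|m IHm] s t.
  by move=> ? ?; apply: closed_pair7 => //; lia.
set k := m.*2 + 7 in IHm *; rewrite (_ : m.+1.*2 + 7 = k.+2); last by lia.
have k_odd : odd k by lia.
move=> st sE.
have -> : t = t - (k.*2 + 3) + k.*2 + odd k + 2 by rewrite k_odd; nia.
apply/closed_pairC/closed_pair_lift.
have [ts|st'] := leqP (t - (k.*2 + 3)) s; first by apply: IHm; nia.
by apply/closed_pairC/IHm; nia.
Qed.

(** Pairing [a] with [c] and [b] with [d] makes both closed trails at least 3 long, because
    [1 < c]. *)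
Lemma realisable_odd k a b c d : odd k -> 5 <= k ->
  0 < a -> a <= b -> b <= c -> c <= d -> 1 < c ->
  2 * (a + b + c + d) = k * k.+1 -> realisable k [:: a; b; c; d].
Proof.
move=> k_odd k5 a0 ab bc cd c1 sE.
have [|v [p [q [L pv qv pE qE]]]] :=
  @closed_pair_odd k (a + c) (b + d) k_odd k5 ltac:(lia); first by lia.
have := @realisable_closed k v p q a b L pv qv ltac:(lia) ltac:(lia).
rewrite pE qE !addKn; apply: realisable_perm.
by apply/permP => P /=; lia.
Qed.

(** Two legs of length 1 cannot form a closed trail of length 2, so here the long leg is grown
    directly. *)
Lemma realisable_odd111 k d : odd k -> 5 <= k ->
  2 * (d + 4) = k * k.+1 -> realisable k [:: d; 1; 1; 1].
Proof.
move=> k_odd k5; have {k_odd k5 k}[m ->] : exists m, k = m.*2 + 5.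
  exists (k - 5)./2; lia.
elim: m d => [|m IHm] d.
  move=> dE; have -> : d = 11 by lia.
  (* Only the edge between the colours 1 and 2 is missed. *)
  exists 0, [:: [:: 3; 4; 2; 2; 3; 3; 1; 1; 4; 4; 0]; [:: 0]; [:: 1]; [:: 2]].
  by split.
set k := m.*2 + 5 in IHm *; rewrite (_ : m.+1.*2 + 5 = k.+2); last by lia.
have k_odd : odd k by lia.
have k5 : 5 <= k by lia.
move=> dE; have -> : d = d - (k.*2 + 3) + k.*2 + odd k + 2.
  by rewrite k_odd; nia.
by apply/realisable_lift1/IHm; nia.
Qed.

(** * Colourings of spiders as systems of trails *)

Section SpiderColouring.
Variables (n : nat) (l : n.-tuple nat).

Notation node := {i : 'I_n & 'I_(tnth l i)}.
Local Notation leg_node j := (Tagged (fun i => 'I_(tnth l i)) j).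

(** Each edge joins a node to its predecessor towards the centre, so the edges are indexed by the
    nodes off the centre. The [insub] never fails. *)
Definition parent (y : node) : spider_vert l :=
  if tagged y == 0 :> nat then None
  else omap (fun j : 'I_(tnth l (tag y)) => leg_node j)
            (insub (tagged y).-1).

Lemma parent0 i (j : 'I_(tnth l i)) : j = 0 :> nat -> parent (leg_node j) = None.
Proof. by move=> j0; rewrite /parent /= j0. Qed.

Lemma parentS i (j j' : 'I_(tnth l i)) : j = j'.+1 :> nat ->
  parent (leg_node j) = Some (leg_node j').
Proof.
move=> jE; rewrite /parent /= jE /= (insubT (fun m => m < tnth l i) (ltn_ord j')).
by congr (Some (leg_node _)); apply: val_inj.
Qed.

Lemma parentP (y : node) :
  (tagged y = 0 :> nat /\ parent y = None) \/
  exists x : node, [/\ tag x = tag y, (tagged x).+1 = tagged y :> nat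
                     & parent y = Some x].
Proof.
case: y => i j; case jE: (nat_of_ord j) => [|m].
  by left; split=> //; exact: (@parent0 i j jE).
have mi : m < tnth l i by rewrite -jE ltnW.
right; exists (leg_node (Ordinal mi)); split=> //; exact: (@parentS i j (Ordinal mi)).
Qed.

Lemma spider_next_parent u (y : node) :
  spider_next u (Some y) = (u == parent y).
Proof.
case: y u => i j [[i' j']|] /=; last first.
  by case: (parentP (leg_node j)) => [[/= -> ->]|[x [_ /= <- ->]]].
apply/andP/eqP => [[/eqP ii' /eqP jj']|].
  by case: _ / ii' j jj' => j jj'; rewrite (@parentS i' j j').
case: (parentP (leg_node j)) => [[_ ->] //|[x [/= xi xj ->]] [xE]].
by rewrite -xj -xi -xE.
Qed.

Lemma spider_adjP u v : spider_adj u v ->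
  exists y : node, (u, v) = (parent y, Some y) \/ (v, u) = (parent y, Some y).
Proof.
case/orP; [case: v => [y|]|case: u => [y|]]; rewrite ?spider_next_parent //.
- by move=> /eqP ->; exists y; left.
- by case: u.
- by move=> /eqP ->; exists y; right.
- by case: v.
Qed.

(** Different nodes with the same edge would be parents of each other, but positions increase from
    parent to child. *)
Lemma parent_edge_inj (y y' : node) :
  [set parent y; Some y] = [set parent y'; Some y'] -> y = y'.
Proof.
move=> E; have := set22 (parent y) (Some y); have := set22 (parent y') (Some y').
rewrite {1}E -{1}E !inE => /orP[/eqP y'E|/eqP[-> //]].
move=> /orP[/eqP yE|/eqP[-> //]].
case: (parentP y) => [[_ y0]|[x [_ xy Ex]]]; first by rewrite y0 in y'E.
case: (parentP y') => [[_ y0]|[x' [_ xy' Ex']]]; first by rewrite y0 in yE.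
move: y'E yE; rewrite Ex Ex' => -[y'x] [yx'].
by move: xy xy'; rewrite -y'x -yx'; lia.
Qed.

Lemma set2_upair k (a b a' b' : 'I_k) :
  ([set a; b] == [set a'; b']) = (upair a b == upair a' b').
Proof.
apply/eqP/eqP => [E|[]].
  have := set21 a b; have := set22 a b; have := set21 a' b'; have := set22 a' b'.
  rewrite {1 2}E -{1 2}E !inE -!val_eqE /= /upair => ? ? ? ?.
  by congr (_, _); lia.
move=> mE ME.
have [[aE bE]|[aE bE]] :
    (a = a' :> nat /\ b = b' :> nat) \/ (a = b' :> nat /\ b = a' :> nat) by lia.
  by rewrite (val_inj aE) (val_inj bE).
by rewrite (val_inj aE) (val_inj bE) setUC.
Qed.

Lemma edge_distinguishingE k (c : {ffun spider l -> 'I_k}) :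
  edge_distinguishing c =
  injectiveb (fun y : node => upair (c (parent y)) (c (Some y))).
Proof.
have adj_parent (y : node) : @adj (spider l) (parent y) (Some y).
  by apply/orP; left; rewrite spider_next_parent.
apply/idP/injectiveP => [/'forall_'forall_'forall_forallP cE y y' yy'|c_inj].
  have := cE (parent y) (Some y) (parent y') (Some y').
  rewrite !adj_parent set2_upair yy' eqxx /= implybF negbK.
  by move=> /eqP/parent_edge_inj.
apply/'forall_'forall_'forall_forallP => u v u' v'.
apply/implyP => /and3P[/spider_adjP[y uv] /spider_adjP[y' uv']].
apply: contra => E; suff yy' : y = y'.
  by case: uv => -[-> ->]; case: uv' => -[-> ->]; rewrite yy' // setUC.
apply: c_inj; apply/eqP; rewrite -set2_upair; move: E.
by case: uv => -[-> ->]; case: uv' => -[-> ->] //; rewrite setUC // [X in _ == X]setUC.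
Qed.

(** Listed leg by leg and outwards, as in [legs_edges], so that the two edge lists are equal and not
    merely permuted. *)
Definition nodes : seq node :=
  [seq leg_node j | i <- enum 'I_n, j <- enum 'I_(tnth l i)].

Lemma perm_nodes : perm_eq nodes (enum {: node}).
Proof.
apply: uniq_perm; rewrite ?enum_uniq //.
  apply: allpairs_uniq_dep => [|i _|[i j] [i' j'] _ _ //]; exact: enum_uniq.
move=> [i j]; rewrite mem_enum; apply/allpairsPdep.
by exists i, j; rewrite !mem_enum.
Qed.

Lemma legs_edges_nodes (f : spider_vert l -> nat) :
  legs_edges (f None)
    [seq [seq f (Some (leg_node j)) | j <- enum 'I_(tnth l i)] | i <- enum 'I_n] =
  [seq upair (f (parent y)) (f (Some y)) | y <- nodes].
Proof.
rewrite /legs_edges /nodes map_flatten -!map_comp; congr flatten.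
apply: eq_map => i /=; rewrite -map_comp (walk_edges_nth 0) size_map size_enum_ord.
rewrite -val_enum_ord -map_comp; apply: eq_map => j /=.
have nthE (j' : 'I_(tnth l i)) :
    nth 0 [seq f (Some (leg_node j)) | j <- enum 'I_(tnth l i)] j' =
    f (Some (leg_node j')).
  by rewrite (nth_map j') ?size_enum_ord // nth_ord_enum.
rewrite nthE; congr upair; case: (parentP (leg_node j)) => /=.
  by move=> [-> ->].
case=> -[i' j'] [/= ii']; case: _ / ii' j nthE => j nthE <- ->.
exact: nthE.
Qed.

Lemma edge_colourableP k : edge_colourable (spider l) k <-> realisable k l.
Proof.
split=> [/andP[k0 /existsP[c]]|[v [ps [ps_l /andP[vk /andP[E_lt E_uniq]]]]]].
  rewrite edge_distinguishingE => c_inj.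
  exists (c None), [seq [seq (c (Some (leg_node j)) : nat) |
    j <- enum 'I_(tnth l i)] | i <- enum 'I_n]; split.
    rewrite -map_comp -[RHS]map_tnth_enum; apply: eq_map => i /=.
    by rewrite size_map size_enum_ord.
  rewrite /legs ltn_ord andTb (legs_edges_nodes (fun u => c u : nat)).
  rewrite (good_perm _ (perm_map _ perm_nodes)); apply/andP; split=> //.
  by apply/allP => _ /mapP[y _ ->]; rewrite gtn_max !ltn_ord.
(* The defaults of [nth] are never reached, as the leg sizes match [l]. *)
pose f (u : spider_vert l) : nat :=
  if u is Some y then nth 0 (nth [::] ps (tag y)) (tagged y) else v.
have size_ps : size ps = n by rewrite -(size_map size) ps_l size_tuple.
have psE : ps = [seq [seq f (Some (leg_node j)) | j <- enum 'I_(tnth l i)] |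
                  i <- enum 'I_n].
  apply: (@eq_from_nth _ [::]); first by rewrite size_map size_enum_ord.
  rewrite size_ps => i ltin; pose o := Ordinal ltin.
  rewrite (nth_map o) ?size_enum_ord // (nth_ord_enum o o).
  have szi : size (nth [::] ps i) = tnth l o.
    by rewrite (tnth_nth 0) -ps_l (nth_map [::]) ?size_ps.
  apply: (@eq_from_nth _ 0); first by rewrite size_map size_enum_ord.
  rewrite szi => j ltj; pose o' := Ordinal ltj.
  by rewrite (nth_map o') ?size_enum_ord // (nth_ord_enum o' o').
have EE := legs_edges_nodes f; rewrite -psE /= in EE.
have f_lt u : f u < k.
  case: u => [y|] //; move: E_lt; rewrite EE all_map => /allP/(_ y).
  rewrite (perm_mem perm_nodes) mem_enum => /(_ isT) /=.
  by rewrite gtn_max => /andP[].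
rewrite /edge_colourable (leq_trans _ vk) //=; apply/existsP.
exists [ffun u => Ordinal (f_lt u)]; rewrite edge_distinguishingE.
rewrite EE (perm_uniq (perm_map _ perm_nodes)) in E_uniq.
apply: etrans E_uniq; congr uniq; apply: eq_map => y.
by rewrite !ffunE.
Qed.

End SpiderColouring.

(** * Upper bounds on the number of edges *)

(* A loop (x, x) contributes 2. *)
Definition deg (x : nat) (E : seq (nat * nat)) : nat :=
  count (fun e => e.1 == x) E + count (fun e => e.2 == x) E.

Lemma deg_cat x E E' : deg x (E ++ E') = deg x E + deg x E'.
Proof. by rewrite /deg !count_cat; lia. Qed.

Lemma perm_deg x E E' : perm_eq E E' -> deg x E = deg x E'.
Proof. by move=> /permP EE'; rewrite /deg !EE'. Qed.

(** Passing through a vertex adds 2 to its degree, so only the two ends matter. *)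
Lemma odd_deg_walk x v p :
  odd (deg x (walk_edges v p)) = (v == x) (+) (last v p == x).
Proof.
elim: p v => [|y p IHp] v /=; first by rewrite addbb.
rewrite -cat1s deg_cat oddD IHp.
have -> : deg x [:: upair v y] = (v == x) + (y == x) by rewrite /deg /=; lia.
by rewrite oddD !oddb -addbA addKb.
Qed.

Lemma odd_deg_legs x v ps :
  odd (deg x (legs_edges v ps)) =
  (odd (size ps) && (v == x)) (+) odd (count_mem x [seq last v p | p <- ps]).
Proof.
elim: ps => //= p ps IHps; rewrite /legs_edges /= deg_cat oddD IHps odd_deg_walk.
by rewrite oddD oddb; case: odd; case: (v == x); case: (_ == x); case: odd.
Qed.

Fixpoint all_edges (k : nat) : seq (nat * nat) :=
  if k is k'.+1 then all_edges k' ++ [seq (i, k') | i <- iota 0 k] else [::].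

Lemma mem_all_edges k e : (e \in all_edges k) = (e.1 <= e.2 < k).
Proof.
case: e => i j; elim: k => [|k IHk]; first by rewrite ltn0 andbF.
rewrite [all_edges _]/(all_edges k ++ [seq (i, k) | i <- iota 0 k.+1]).
rewrite mem_cat IHk /= ltnS (leq_eqVlt j).
have -> : ((i, j) \in [seq (i, k) | i <- iota 0 k.+1]) = (i <= k) && (j == k).
  apply/mapP/andP => [[i' + [-> ->]]|[ik /eqP ->]].
    by rewrite mem_iota.
  by exists i; rewrite ?mem_iota.
by lia.
Qed.

Lemma all_edges_uniq k : uniq (all_edges k).
Proof.
elim: k => // k IHk.
rewrite [all_edges _]/(all_edges k ++ [seq (i, k) | i <- iota 0 k.+1]).
rewrite cat_uniq IHk map_inj_uniq ?iota_uniq ?andbT => [|? ? []//].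
by apply/hasPn => _ /mapP[i _ ->]; rewrite mem_all_edges /= ltnn andbF.
Qed.

Lemma size_all_edges k : 2 * size (all_edges k) = k * k.+1.
Proof.
elim: k => // k IHk.
rewrite [all_edges _]/(all_edges k ++ [seq (i, k) | i <- iota 0 k.+1]).
by rewrite size_cat size_map size_iota; lia.
Qed.

Lemma deg_all_edges k x : x < k -> deg x (all_edges k) = k.+1.
Proof.
elim: k => // k IHk xk.
rewrite [all_edges _]/(all_edges k ++ [seq (i, k) | i <- iota 0 k.+1]) deg_cat.
have -> : deg x [seq (i, k) | i <- iota 0 k.+1] = 1 + (k == x) * k.+1.
  rewrite /deg !count_map; congr (_ + _).
    by rewrite -[LHS]/(count_mem x _) count_uniq_mem ?iota_uniq // mem_iota xk.
  rewrite (eq_count (a2 := fun=> k == x)) //; case: (k == x).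
    by rewrite (eq_count (a2 := predT)) // count_predT size_iota mul1n.
  by rewrite (eq_count (a2 := pred0)) // count_pred0.
move: xk; rewrite ltnS leq_eqVlt => /predU1P[->|xk].
  rewrite eqxx mul1n; suff -> : deg k (all_edges k) = 0 by [].
  apply/eqP; rewrite addn_eq0 !eqn0Ngt -!has_count.
  apply/andP; split; apply/hasPn => e; rewrite mem_all_edges /=; lia.
by rewrite IHk // gtn_eqF // addn1.
Qed.

Lemma sum_eq_ord k i : i < k -> \sum_(x < k) (i == x) = 1.
Proof.
move=> ik; rewrite (bigD1 (Ordinal ik)) //= eqxx big1 // => x.
by rewrite -val_eqE eq_sym => /negPf /= ->.
Qed.

Lemma handshake k (E : seq (nat * nat)) : (forall e, e \in E -> e.1 < k /\ e.2 < k) ->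
  \sum_(x < k) deg x E = 2 * size E.
Proof.
elim: E => [|e E IHE] Ek; first by rewrite big1.
have [e1 e2] := Ek e (mem_head _ _).
under eq_bigr => x _ do rewrite -cat1s deg_cat.
rewrite big_split /= IHE => [|e' e'E]; last by apply: Ek; rewrite inE e'E orbT.
under eq_bigr => x _ do rewrite /deg /= !addn0.
by rewrite big_split /= !sum_eq_ord // mulnS.
Qed.

Lemma sum_count_mem k s : \sum_(x < k) count_mem (x : nat) s <= size s.
Proof.
elim: s => [|y s IHs]; first by rewrite big1.
rewrite /= big_split /= -addn1 addnC leq_add //.
have [yk|ky] := ltnP y k; first by rewrite sum_eq_ord.
rewrite big1 // => x _; apply/eqP; rewrite eqb0 gtn_eqF //.
exact: leq_trans (ltn_ord x) ky.
Qed.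

Lemma size_legs_edges v ps : size (legs_edges v ps) = sumn (map size ps).
Proof.
by elim: ps => //= p ps IHps; rewrite size_cat size_walk_edges -IHps.
Qed.

Lemma legs_edges_le v ps e : e \in legs_edges v ps -> e.1 <= e.2.
Proof.
case/flattenP => _ /mapP[p _ ->]; elim: p v => //= y p IHp v.
by rewrite inE => /predU1P[->|/IHp//]; rewrite /upair /=; lia.
Qed.

(** [M] lists the missed edges; lower bounds on its size are upper bounds on the total length. *)
Lemma legs_complement k v ps : legs k v ps ->
  exists2 M : seq (nat * nat), perm_eq (legs_edges v ps ++ M) (all_edges k) &
    2 * (sumn (map size ps) + size M) = k * k.+1.
Proof.
case/andP => _ /andP[/allP E_lt E_uniq].
set M := [seq e <- all_edges k | e \notin legs_edges v ps].
suff EM : perm_eq (legs_edges v ps ++ M) (all_edges k).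
  by exists M => //; rewrite -size_all_edges -(perm_size EM) size_cat size_legs_edges.
apply: uniq_perm.
- rewrite cat_uniq E_uniq filter_uniq ?all_edges_uniq // andbT /=.
  by apply/hasPn => e; rewrite mem_filter => /andP[].
- exact: all_edges_uniq.
move=> e; rewrite mem_cat mem_filter orb_andr orbN /= mem_all_edges.
have [eE|] //= := boolP (e \in _).
by rewrite (legs_edges_le eE) E_lt.
Qed.

Lemma realisable_size k ls : realisable k ls -> 2 * sumn ls <= k * k.+1.
Proof.
by move=> [v [ps [<- /legs_complement[M _]]]]; lia.
Qed.

(* For even k every colour has odd degree k+1 in the complete graph with loops,
   so each colour that ends no leg meets a missing edge. *)
Lemma realisable_size_even k ls : ~~ odd k -> size ls = 4 ->
  realisable k ls -> 2 * sumn ls <= k * k + 4.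
Proof.
move=> k_even sz_ls [v [ps [psE /legs_complement[M EM szM]]]].
have sz_ps : size ps = 4 by rewrite -sz_ls -psE size_map.
have M_lt e : e \in M -> e.1 < k /\ e.2 < k.
  move=> eM; have : e \in all_edges k by rewrite -(perm_mem EM) mem_cat eM orbT.
  by rewrite mem_all_edges; lia.
pose ends := [seq last v p | p <- ps].
have sum_ge : k <= \sum_(x < k) (deg x M + count_mem (x : nat) ends).
  rewrite -[X in X <= _]card_ord -sum1_card leq_sum // => x _.
  have := perm_deg x EM; rewrite deg_cat deg_all_edges //.
  have := odd_deg_legs x v ps; rewrite sz_ps /= -/ends.
  by case: (count_mem _ _) => //=; lia.
(* Handshake for [M] and the four leg ends give [k <= 2 * size M + 4]. *)
have := sum_count_mem k ends; rewrite size_map sz_ps.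
move: sum_ge; rewrite big_split /= handshake //.
by rewrite psE in szM; lia.
Qed.

(** With no edge missed all degrees are even, so each colour ends an even number of legs. But the
    short legs end in three distinct colours, and the fourth end can match only one of them. *)
Lemma realisable_size_odd111 k l : odd k -> realisable k [:: 1; 1; 1; l] ->
  2 * (l + 4) <= k * k.+1.
Proof.
move=> k_odd [v [ps [psE L]]]; have [M EM] := legs_complement L.
rewrite psE /= => szM.
case: M szM EM => [|e M] /= szM EM; first last; first lia.
case: ps psE L EM => [|[|a []] [|[|b []] [|[|c []] [|p []]]]] //= _ L.
rewrite cats0 => EM; exfalso; move: L.
rewrite /legs /good /legs_edges /= !gtn_max -!andbA.
case/and5P => _ _ ak _ /and5P[bk _ ck _ /and4P[+ + _ _]].
rewrite !inE !negb_or => /and3P[ab ac _] /andP[bc _].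
have {}ab : a != b by apply: contraNneq ab => ->.
have {}ac : a != c by apply: contraNneq ac => ->.
have {}bc : b != c by apply: contraNneq bc => ->.
have ends_even x : x < k -> ~~ odd (count_mem x [:: a; b; c; last v p]).
  move=> xk; have := odd_deg_legs x v [:: [:: a]; [:: b]; [:: c]; p].
  by rewrite (perm_deg x EM) deg_all_edges //= k_odd => <-.
have := ends_even a ak; have := ends_even b bk; rewrite /=.
by rewrite !eqxx; lia.
Qed.

(** The four edges at the centre are distinct, hence so are the first colours of the legs. *)
Lemma realisable_centre k a b c d : 0 < a -> 0 < b -> 0 < c -> 0 < d ->
  realisable k [:: a; b; c; d] -> 4 <= k.
Proof.
case: a b c d => [|a] [|b] [|c] [|d] // _ _ _ _ [v [ps [psE L]]].
case: ps psE L => [|[|a1 p1] [|[|a2 p2] [|[|a3 p3] [|[|a4 p4] []]]]] //= _.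
case/andP => _ /andP[/allP E_lt E_uniq].
pose A := [:: a1; a2; a3; a4].
have A_sub : subseq (map (upair v) A) (legs_edges v [:: a1 :: p1; a2 :: p2; a3 :: p3; a4 :: p4]).
  rewrite /legs_edges /= !eqxx cats0.
  do 3 rewrite (subseq_trans _ (suffix_subseq _ _)) //= ?eqxx.
  by rewrite sub0seq.
have A_uniq : uniq A := map_uniq (subseq_uniq A_sub E_uniq).
rewrite -[4]/(size A) -(size_iota 0 k) uniq_leq_size // => x xA.
have := E_lt _ (mem_subseq A_sub (map_f (upair v) xA)).
by rewrite mem_iota gtn_max => /andP[].
Qed.

(* The central colour recurs among its four neighbours, through its loop, and
   the leg using the loop cannot leave it. *)
Lemma not_realisable_2222 : ~ realisable 4 [:: 2; 2; 2; 2].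
Proof.
move=> [v [ps [psE /andP[v4]]]].
case: ps psE => [|[|a1 [|b1 []]] [|[|a2 [|b2 []]]
  [|[|a3 [|b3 []]] [|[|a4 [|b4 []]] []]]]] //= _.
pose A := [:: a1; a2; a3; a4].
pose F := [:: upair a1 b1; upair a2 b2; upair a3 b3; upair a4 b4].
rewrite (@good_perm _ _ (map (upair v) A ++ F)); last first.
  by apply/permP => P; rewrite /legs_edges /=; lia.
case/andP; rewrite all_cat cat_uniq => /andP[/allP A_lt /allP F_lt].
case/and3P => /map_uniq A_uniq /hasPn FA _.
have A_all x : x < 4 -> x \in A.
  have A_iota y : y \in A -> y \in iota 0 4.
    by move=> /(map_f (upair v))/A_lt; rewrite mem_iota gtn_max => /andP[].
  have [_ ->] := uniq_min_size A_uniq A_iota isT.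
  by rewrite mem_iota.
(* As [A] contains all colours, a second edge leaving [v] would repeat a first one. *)
have no_exit x y : upair x y \in F -> x <> v.
  move=> xyF xv; have /negP[] := FA _ xyF; rewrite xv map_f //.
  by apply: A_all; have := F_lt _ xyF; rewrite gtn_max => /andP[].
have := A_all v v4; rewrite !inE.
by case/or4P => /eqP vE; [case: (@no_exit a1 b1) | case: (@no_exit a2 b2) |
  case: (@no_exit a3 b3) | case: (@no_exit a4 b4)]; rewrite ?inE ?eqxx ?orbT.
Qed.

(** * The edge-distinguishing number *)

Lemma edge_distinguishing_number_eq n (l : n.-tuple nat) k :
  realisable k.+1 l -> ~ realisable k l ->
  edge_distinguishing_number (spider l) = k.+1.
Proof.
move=> /edge_colourableP kl not_kl; rewrite /edge_distinguishing_number.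
case: ex_minnP => m /edge_colourableP ml m_min.
apply/eqP; rewrite eqn_leq m_min //= ltnNge; apply/negP => mk.
exact: not_kl (realisable_leq mk ml).
Qed.

(** This reduces bounds on the total to the extremal totals, reached by extending the last leg. *)
Lemma realisable_shorten k a b c d d' : d <= d' ->
  realisable k [:: a; b; c; d'] -> realisable k [:: a; b; c; d].
Proof.
move=> dd' /(@realisable_catC k [:: a; b; c] [:: d']) R.
exact: (@realisable_catC k [:: d]) (realisable_take dd' R).
Qed.

Section Realisable4.
Variables a b c d : nat.
Hypotheses (a_gt0 : 0 < a) (ab : a <= b) (bc : b <= c) (cd : c <= d).

Lemma realisable_upto_odd k : odd k -> 5 <= k -> 1 < c ->
  2 * (a + b + c + d) <= k * k.+1 -> realisable k [:: a; b; c; d].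
Proof.
move=> k_odd k5 c1 dk; have k2 : ~~ odd (k * k.+1) by rewrite oddM /= k_odd.
apply: (@realisable_shorten _ _ _ _ _ ((k * k.+1)./2 - (a + b + c))).
  by lia.
by apply: realisable_odd => //; lia.
Qed.

Lemma realisable_upto_even k : ~~ odd k -> 6 <= k ->
  2 * (a + b + c + d) <= k * k + 4 -> realisable k [:: a; b; c; d].
Proof.
move=> k_even k6 dk; have k2 : ~~ odd (k * k) by rewrite oddM (negPf k_even).
apply: (@realisable_shorten _ _ _ _ _ ((k * k)./2 + 2 - (a + b + c))).
  by lia.
by apply: realisable_even => //=; lia.
Qed.

Lemma realisable_upto4 : a = 1 -> a + b + c + d <= 10 ->
  realisable 4 [:: a; b; c; d].
Proof.
move=> a1; rewrite a1 => sE.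
apply: (@realisable_shorten _ _ _ _ _ (9 - b - c)); first by lia.
by apply: realisable4; lia.
Qed.

End Realisable4.

Lemma realisable_upto_odd111 k d : odd k -> 5 <= k ->
  2 * (d + 4) <= k * k.+1 -> realisable k [:: 1; 1; 1; d].
Proof.
move=> k_odd k5 dk; have k2 : ~~ odd (k * k.+1) by rewrite oddM /= k_odd.
apply: (@realisable_shorten _ _ _ _ _ ((k * k.+1)./2 - 4)); first by lia.
apply: (@realisable_catC k [:: _] [:: 1; 1; 1]).
by apply: realisable_odd111 => //; lia.
Qed.

(** * Evaluation of the ceilings and conclusion *)

Import Order.TTheory GRing.Theory Num.Theory.
Local Open Scope ring_scope.

(** For natural [n], [sqrt(8m + 1) <= 2n + 1] iff [2m <= n(n + 1)], so the ceiling is the least such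
    [n]. *)
Lemma ceil_triangular (R : realType) (m a : nat) :
  (a * a.+1 < 2 * m <= a.+1 * a.+2)%N ->
  Num.ceil ((- 1 + Num.sqrt (8 * m%:R + 1)) / 2 : R) = a.+1.
Proof.
move=> /andP[lo hi]; apply: ceil_def.
rewrite -[in X in X < _](addn1 a) PoszD addrK -!pmulrn.
set s := Num.sqrt _; have s0 : 0 <= s by exact: sqrtr_ge0.
have m0 : 0 <= m%:R :> R by exact: ler0n.
have a0 : 0 <= a%:R :> R by exact: ler0n.
have s2 : s * s = 8 * m%:R + 1 by rewrite -expr2 sqr_sqrtr //; lra.
move: lo hi; rewrite -(ltr_nat R) -(ler_nat R) !natrM -(@natr1 R a.+1).
rewrite -(@natr1 R a); set x : R := a%:R in a0 *.
set y : R := m%:R in m0 s2 * => lo hi.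
apply/andP; split; rewrite ?ltNge ?leNgt; apply/negP => h.
  have sx : s <= 2 * x + 1 by lra.
  have : s * s <= (2 * x + 1) * (2 * x + 1) by apply: ler_pM; lra.
  by nra.
have sx : 2 * x + 3 < s by lra.
have : (2 * x + 3) * (2 * x + 3) < s * s by apply: ltr_pM; lra.
by nra.
Qed.

Lemma ceil_sqrt (R : realType) (e b : nat) :
  (b * b + 4 < 2 * e <= b.+1 * b.+1 + 4)%N ->
  Num.ceil (Num.sqrt (2 * e%:R - 4) : R) = b.+1.
Proof.
move=> /andP[lo hi]; apply: ceil_def.
rewrite -[in X in X < _](addn1 b) PoszD addrK -!pmulrn.
set s := Num.sqrt _; have s0 : 0 <= s by exact: sqrtr_ge0.
have b0 : 0 <= b%:R :> R by exact: ler0n.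
move: lo hi; rewrite -(ltr_nat R) -(ler_nat R) !natrD !natrM -natr1 => lo hi.
have s2 : s * s = 2 * e%:R - 4 by rewrite -expr2 sqr_sqrtr //; nra.
apply/andP; split.
  by rewrite ltNge; apply/negP => h; nra.
by rewrite leNgt; apply/negP => h; nra.
Qed.

(** Here [m] is [e + 1] for legs 1,1,1,l and [e] otherwise. Let [a + 1] be the least [n] with
    [2m <= n(n + 1)]. If it is odd, it is the answer; if even, the answer is [a + 1] or [a + 2],
    according to whether [2e <= (a + 1)^2 + 4]. *)
Lemma edge_distinguishing_number_ceil (R : realType) n (l : n.-tuple nat)
    (e m : nat) :
  (11 <= e <= m)%N -> (m <= e.+1)%N ->
  (forall k, odd k -> 5 <= k -> 2 * m <= k * k.+1 -> realisable k l)%N ->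
  (forall k, odd k -> realisable k l -> 2 * m <= k * k.+1)%N ->
  (forall k, ~~ odd k -> 6 <= k -> 2 * e <= k * k + 4 -> realisable k l)%N ->
  (forall k, ~~ odd k -> realisable k l -> 2 * e <= k * k + 4)%N ->
  let a : int := Num.ceil ((- 1 + Num.sqrt (8 * m%:R + 1)) / 2 : R) in
  Posz (edge_distinguishing_number (spider l)) =
  if odd `|a|%N then a else Num.ceil (Num.sqrt (2 * e%:R - 4) : R).
Proof.
move=> /andP[e11 em] me up_odd low_odd up_even low_even.
have [a aP] : exists a, (a * a.+1 < 2 * m <= a.+1 * a.+2)%N.
  have ex_a : exists a, (2 * m <= a * a.+1)%N by exists m; nia.
  case: (ex_minnP ex_a) => -[|a] ma a_min; first by lia.
  by exists a; rewrite ma ltnNge andbT; apply/negP => /a_min; rewrite ltnn.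
rewrite /= (ceil_triangular R aP) /=; case/andP: aP => lo hi.
have a4 : (4 <= a)%N by nia.
(* The names refer to the parity of the ceiling [a.+1]. *)
have [a_even|a_odd] := boolP (odd a) => /=; last first.
  rewrite (@edge_distinguishing_number_eq _ l a) //.
    by apply: up_odd => //=; lia.
  (* Here [a^2 + a + 2 <= 2m <= 2e + 2 <= a^2 + 6], so [a <= 4]; then [e >= 11] excludes 4. *)
  move=> /(low_even _ a_odd) ae; have a4' : a = 4%N by nia.
  by rewrite a4' in ae lo hi; lia.
have [ea|ae] := leqP (2 * e)%N (a.+1 * a.+1 + 4).
  rewrite (@ceil_sqrt R e a) ?ea ?andbT; last by nia.
  rewrite (@edge_distinguishing_number_eq _ l a) //.
    by apply: up_even => //=; lia.
  by move=> /(low_odd _ a_even); rewrite leqNgt lo.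
rewrite (@ceil_sqrt R e a.+1); last by nia.
rewrite (@edge_distinguishing_number_eq _ l a.+1) //.
  by apply: up_odd => /=; rewrite ?negbK //; nia.
by move=> /low_even; rewrite /= a_even leqNgt ae => /(_ isT).
Qed.

Theorem theorem4p3 (R : realType) (l1 l2 l3 l4 e : nat)
    (l1_gt0 : (0 < l1)%N) (l12 : (l1 <= l2)%N) (l23 : (l2 <= l3)%N)
    (l34 : (l3 <= l4)%N) (eE : e = (l1 + l2 + l3 + l4)%N) :
  let lam := Posz (edge_distinguishing_number
                     (spider [tuple l1; l2; l3; l4])) in
  let a9 : int := Num.ceil ((- 1 + Num.sqrt (8 * e%:R + 9)) / 2 : R) in
  let a1 : int := Num.ceil ((- 1 + Num.sqrt (8 * e%:R + 1)) / 2 : R) in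
  let b : int := Num.ceil (Num.sqrt (2 * e%:R - 4) : R) in
  ([/\ l1 = 1%N, l2 = 1%N & l3 = 1%N] ->
     lam = if (e <= 10)%N then 4
           else if (11 <= e)%N && odd `|a9|%N then a9
           else b)
  /\
  ((2 <= l3)%N ->
     lam = if (e <= 10)%N && (l1 == 1%N) then 4
           else if (e <= 10)%N && (l1 == 2%N) then 5
           else if (11 <= e)%N && odd `|a1|%N then a1
           else b).
Proof.
set l := [tuple l1; l2; l3; l4]; move=> lam a9 a1 b.
have lE : l = [:: l1; l2; l3; l4] :> seq nat by [].
have sumE : sumn l = e by rewrite lE eE /=; lia.
have not3 : ~ realisable 3 l.
  by move=> R3; have := realisable_centre _ _ _ _ R3; lia.
have lam4 : (e <= 10)%N -> l1 = 1%N -> lam = 4.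
  move=> e10 l1E; rewrite /lam (@edge_distinguishing_number_eq _ l 3) //.
  by apply: realisable_upto4 => //; rewrite -eE.
have up_even k : ~~ odd k -> (6 <= k -> 2 * e <= k * k + 4 -> realisable k l)%N.
  by move=> *; apply: realisable_upto_even; rewrite -?eE.
have low_even k : ~~ odd k -> realisable k l -> (2 * e <= k * k + 4)%N.
  by rewrite -sumE => k_even; apply: realisable_size_even.
split=> [[l1E l2E l3E]|l3_ge2].
  have [e10|e11] := leqP e 10; first exact: lam4.
  have lE1 : l = [:: 1; 1; 1; l4]%N :> seq nat by rewrite lE l1E l2E l3E.
  have eE1 : (l4 + 4 = e.+1)%N by lia.
  (* The one edge always missed turns [e] into [e + 1]: [8e + 9 = 8(e + 1) + 1]. *)
  have -> : a9 = Num.ceil ((- 1 + Num.sqrt (8 * e.+1%:R + 1)) / 2 : R).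
    by rewrite /a9 -(@natr1 R e); congr (Num.ceil ((- 1 + Num.sqrt _) / 2)); lra.
  apply: edge_distinguishing_number_ceil => // [|k k_odd k5|k k_odd]; first lia.
    by rewrite lE1 -eE1; exact: realisable_upto_odd111.
  by rewrite lE1 -eE1; exact: realisable_size_odd111.
have [e10|e11] := leqP e 10.
  have [l1E|l1_ne1] /= := eqVneq l1 1%N; first exact: lam4.
  have -> : l1 = 2%N by lia.
  rewrite /lam (@edge_distinguishing_number_eq _ l 4) //.
    by apply: realisable_upto_odd; lia.
  move=> R4; apply: not_realisable_2222.
  (* Each use shortens the first leg to 2 and moves it to the end; four uses reach 2,2,2,2. *)
  have take2 x s : (2 <= x)%N -> realisable 4 (x :: s) ->
      realisable 4 (s ++ [:: 2]%N).
    by move=> x2 /(realisable_take x2); apply: (@realisable_catC 4 [:: 2]%N).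
  have R1 := take2 l1 [:: l2; l3; l4] ltac:(lia) R4.
  have R2 := take2 l2 [:: l3; l4; 2]%N ltac:(lia) R1.
  have R3 := take2 l3 [:: l4; 2; 2]%N l3_ge2 R2.
  exact: (take2 l4 [:: 2; 2; 2]%N ltac:(lia) R3).
apply: edge_distinguishing_number_ceil; rewrite ?leqnn ?andbT //.
  by move=> k k_odd k5 ke; apply: realisable_upto_odd; rewrite -?eE.
by move=> k _ /realisable_size; rewrite sumE.
Qed.
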